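(* Let $i\in\mathbb{C}$ be the imaginary unit, and let $\mathcal{L}=\{L_0,\dots,L_9\}$ be the set of ten mutually skew lines in $\mathbb{P}^3_{\mathbb{C}}$ in which $L_j$ is spanned by the following two points: $L_0$: $(0,0,1,0)$, $(0,0,0,1)$; $L_1$: $(0,1,0,-i)$, $(1,0,i,0)$; $L_2$: $(0,1,1,0)$, $(1,0,0,-1)$; $L_3$: $(0,1,i,0)$, $(1,0,0,i)$; $L_4$: $(0,1,-1,0)$, $(1,0,0,1)$; $L_5$: $(0,1,-i,0)$, $(1,0,0,-i)$; $L_6$: $(0,1,0,1)$, $(1,0,1,0)$; $L_7$: $(1,0,0,0)$, $(0,1,0,0)$; $L_8$: $(0,1,0,i)$, $(1,0,-i,0)$; $L_9$: $(0,1,0,-1)$, $(1,0,-1,0)$. Let $\Pi$ be the composition-closure of the set of morphisms of the form $\pi(L,L',L'')$ with $L,L',L''\in\mathcal{L}$ (and $L\cap L'=L'\cap L''=\varnothing$, so that the map is defined). Then the groupoid $(\mathcal{L},\Pi)$ has automorphism group $\mathrm{Aut}_{(\mathcal{L},\Pi)}\cong S_4$; that is, $\mathrm{Aut}_{(\mathcal{L},\Pi)}(L)\cong S_4$ for every $L\in\mathcal{L}$.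
   Context: Projection maps: for lines $L,L',L''\subseteq\mathbb{P}^3_{\mathbb{C}}$ with $L\cap L'=L'\cap L''=\varnothing$, the isomorphism $\pi(L,L',L''):L\to L''$ sends a point $P\in L$ to the unique point of $L''\cap H$, where $H$ is the unique plane containing $P$ and $L'$. The composition-closure of a set of such maps is the set of all compositions of finite composable sequences of them. The groupoid $(\mathcal{L},\Pi)$ has the lines in $\mathcal{L}$ as objects and the elements of $\Pi$ as morphisms; $\mathrm{Aut}_{(\mathcal{L},\Pi)}(L)$ is the group of all elements of $\Pi$ that are maps $L\to L$. A groupoid is regular if the automorphism groups of all its objects are isomorphic; then $\mathrm{Aut}_{(\mathcal{L},\Pi)}$ denotes their common isomorphism class. *)

(* Defs.v *)
From HB Require Import structures.
From mathcomp Require Import all_boot all_order all_fingroup all_algebra.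
From mathcomp Require Import boolp classical_sets reals complex lra.

Set Implicit Arguments.
Unset Strict Implicit.
Unset Printing Implicit Defensive.

Import GRing.Theory Num.Theory.
Local Open Scope ring_scope.

(* Linear subspaces of P^3 over F are vector subspaces of F^4: points, lines
   and planes have vector space dimension 1, 2 and 3, incidence is inclusion,
   and two subspaces are disjoint in P^3 iff they intersect in 0. *)
Definition line (F : fieldType) :=
  {L : {vspace 'rV[F]_4} | \dim L == 2%N}.

Definition point_on (F : fieldType) (L : line F) :=
  {P : {vspace 'rV[F]_4} | (\dim P == 1%N) && (P <= val L)%VS}.

Definition skew (F : fieldType) (L M : line F) : bool :=
  (val L :&: val M == 0)%VS.

Lemma dim_point (F : fieldType) (L : line F) (P : point_on L) :
  \dim (val P) = 1%N.
Proof. by case/andP: (valP P) => /eqP. Qed.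

Lemma point_sub (F : fieldType) (L : line F) (P : point_on L) :
  (val P <= val L)%VS.
Proof. by case/andP: (valP P). Qed.

Definition span_plane (F : fieldType) (L L' : line F) (P : point_on L) :
  {vspace 'rV[F]_4} := (val P + val L')%VS.

Lemma dim_span_plane (F : fieldType) (L L' : line F) (P : point_on L) :
  skew L L' -> \dim (span_plane L' P) = 3%N.
Proof.
move=> /eqP LL'.
have PL' : (val P :&: val L')%VS = 0%VS.
  by apply/eqP; rewrite -subv0 -LL'; apply: capvS => //; apply: point_sub.
by rewrite dimv_disjoint_sum // dim_point (eqP (valP L')).
Qed.

Lemma span_plane_unique (F : fieldType) (L L' : line F) (P : point_on L)
    (H : {vspace 'rV[F]_4}) :
  skew L L' -> \dim H = 3%N -> (val P <= H)%VS -> (val L' <= H)%VS ->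
  H = span_plane L' P.
Proof.
move=> sk dH PH L'H; apply/esym/eqP.
by rewrite eqEdim subv_add PH L'H /= dH dim_span_plane.
Qed.

Lemma dim_proj (F : fieldType) (L L' L'' : line F) (P : point_on L) :
  skew L L' -> skew L' L'' ->
  (\dim (span_plane L' P :&: val L'') == 1%N) &&
  (span_plane L' P :&: val L'' <= val L'')%VS.
Proof.
move=> sk /eqP sk'; rewrite capvSr andbT.
have d4 : \dim (fullv : {vspace 'rV[F]_4}) = 4%N by rewrite dimvf.
have full : (span_plane L' P + val L'')%VS = fullv.
  apply/eqP; rewrite eqEdim subvf d4.
  have d : \dim (val L' + val L'') = 4%N.
    by rewrite dimv_disjoint_sum // (eqP (valP L')) (eqP (valP L'')).
  by rewrite -[X in (X <= _)%N]d; apply: dimvS; apply: addvS => //; apply: addvSr.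
have := dimv_sum_cap (span_plane L' P) (val L'').
rewrite full d4 dim_span_plane // (eqP (valP L'')).
by rewrite -[(3 + 2)%N]/(4 + 1)%N => /addnI ->.
Qed.

Definition proj (F : fieldType) (L L' L'' : line F)
    (sk : skew L L') (sk' : skew L' L'') (P : point_on L) : point_on L'' :=
  exist _ (span_plane L' P :&: val L'')%VS (dim_proj P sk sk').

Lemma proj_unique (F : fieldType) (L L' L'' : line F)
    (sk : skew L L') (sk' : skew L' L'') (P : point_on L) (Q : point_on L'') :
  (val Q <= span_plane L' P)%VS <-> Q = proj sk sk' P.
Proof.
split=> [QH|->]; last exact: capvSl.
apply/val_inj/eqP.
by rewrite eqEdim subv_cap QH point_sub !dim_point.
Qed.

Lemma skewC (F : fieldType) (L M : line F) : skew L M = skew M L.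
Proof. by rewrite /skew capvC. Qed.

(* The composition-closure of the projections between lines of S. The empty
   compositions are included, so that (S, Pi) is a groupoid whatever S is; they
   add nothing when L has a skew line L' in S, since pi(L, L', L) = id. *)
Inductive Pi (F : fieldType) (S : set (line F)) :
    forall L M : S, (point_on (val L) -> point_on (val M)) -> Prop :=
| Pi_proj (L L' L'' : S) (sk : skew (val L) (val L'))
    (sk' : skew (val L') (val L'')) : Pi (proj sk sk')
| Pi_id (L : S) : @Pi F S L L id
| Pi_comp (L M N : S) (f : point_on (val L) -> point_on (val M))
    (g : point_on (val M) -> point_on (val N)) :
    Pi f -> Pi g -> Pi (g \o f).

Record groupoid_aut (F : fieldType) (S : set (line F)) (L : S) := GroupoidAut {
  aut_fun :> point_on (val L) -> point_on (val L);
  aut_Pi : Pi aut_fun }.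

Lemma proj_id (F : fieldType) (L L' : line F)
    (sk : skew L L') (sk' : skew L' L) (P : point_on L) : proj sk sk' P = P.
Proof. by apply/esym/proj_unique; apply: addvSl. Qed.

Lemma projK (F : fieldType) (L L' L'' : line F)
    (sk : skew L L') (sk' : skew L' L'')
    (rsk : skew L'' L') (rsk' : skew L' L) :
  cancel (proj sk sk') (proj rsk rsk').
Proof.
move=> P; apply/esym/proj_unique.
rewrite -(@span_plane_unique _ _ L' (proj sk sk' P) (span_plane L' P)) //.
- exact: addvSl.
- exact: dim_span_plane.
- exact: capvSl.
- exact: addvSr.
Qed.

Lemma Pi_inv (F : fieldType) (S : set (line F)) (L M : S)
    (f : point_on (val L) -> point_on (val M)) :
  Pi f -> exists g, [/\ Pi g, cancel f g & cancel g f].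
Proof.
elim=> {L M f}.
- move=> L L' L'' sk sk'.
  have [rsk rsk'] : skew (val L'') (val L') /\ skew (val L') (val L).
    by rewrite skewC sk' skewC sk.
  by exists (proj rsk rsk'); split; [apply: Pi_proj|exact: projK|exact: projK].
- by move=> L; exists id; split=> //; apply: Pi_id.
- move=> L M N f g _ [f' [Pf' fK f'K]] _ [g' [Pg' gK g'K]].
  by exists (f' \o g'); split; [apply: Pi_comp|exact: can_comp|exact: can_comp].
Qed.

Lemma aut_eq (F : fieldType) (S : set (line F)) (L : S) (f g : groupoid_aut L) :
  aut_fun f = aut_fun g -> f = g.
Proof. by case: f g => [f Pf] [g Pg] /= e; subst g; rewrite (Prop_irrelevance Pf Pg). Qed.

(* Product in the group: f * g is the composite f \o g. *)
Definition aut_mul (F : fieldType) (S : set (line F)) (L : S) (f g : groupoid_aut L) :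
  groupoid_aut L := GroupoidAut (Pi_comp (aut_Pi g) (aut_Pi f)).

Definition aut_one (F : fieldType) (S : set (line F)) (L : S) : groupoid_aut L :=
  GroupoidAut (Pi_id L).

Lemma aut_inv_subproof (F : fieldType) (S : set (line F)) (L : S) (f : groupoid_aut L) :
  {g : groupoid_aut L | cancel f g /\ cancel g f}.
Proof.
apply: cid; have [g [Pg fK gK]] := Pi_inv (aut_Pi f).
by exists (GroupoidAut Pg).
Qed.

Definition aut_inv (F : fieldType) (S : set (line F)) (L : S) (f : groupoid_aut L) :
  groupoid_aut L := sval (aut_inv_subproof f).

Lemma aut_mulA (F : fieldType) (S : set (line F)) (L : S) :
  associative (@aut_mul F S L).
Proof. by move=> f g h; apply: aut_eq. Qed.

Lemma aut_mul1 (F : fieldType) (S : set (line F)) (L : S) :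
  left_id (aut_one L) (@aut_mul F S L).
Proof. by move=> f; apply: aut_eq. Qed.

Lemma aut_mulr1 (F : fieldType) (S : set (line F)) (L : S) :
  right_id (aut_one L) (@aut_mul F S L).
Proof. by move=> f; apply: aut_eq. Qed.

Lemma aut_mulV (F : fieldType) (S : set (line F)) (L : S) :
  left_inverse (aut_one L) (@aut_inv F S L) (@aut_mul F S L).
Proof.
move=> f; apply: aut_eq; rewrite /aut_inv.
by case: aut_inv_subproof => g /= [fK gK]; apply/funext.
Qed.

Lemma aut_mulrV (F : fieldType) (S : set (line F)) (L : S) :
  right_inverse (aut_one L) (@aut_inv F S L) (@aut_mul F S L).
Proof.
move=> f; apply: aut_eq; rewrite /aut_inv.
by case: aut_inv_subproof => g /= [fK gK]; apply/funext.
Qed.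

HB.instance Definition _ (F : fieldType) (S : set (line F)) (L : S) :=
  gen_eqMixin (groupoid_aut L).
HB.instance Definition _ (F : fieldType) (S : set (line F)) (L : S) :=
  gen_choiceMixin (groupoid_aut L).
HB.instance Definition _ (F : fieldType) (S : set (line F)) (L : S) :=
  isGroup.Build (groupoid_aut L) (@aut_mulA F S L) (@aut_mul1 F S L) (@aut_mulr1 F S L)
    (@aut_mulV F S L) (@aut_mulrV F S L).

Definition isomorphic_groups (G H : groupType) : Prop :=
  exists f : {multiplicative G -> H}, bijective f.

Definition vec4 (F : fieldType) (a b c d : F) : 'rV[F]_4 :=
  \row_k [:: a; b; c; d]`_k.

Definition spanning_points (R : realType) : seq ('rV[R[i]]_4 * 'rV[R[i]]_4) :=
  let i : R[i] := 'i%C in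
  [:: (vec4 0 0 1 0,     vec4 0 0 0 1);
      (vec4 0 1 0 (- i), vec4 1 0 i 0);
      (vec4 0 1 1 0,     vec4 1 0 0 (-1));
      (vec4 0 1 i 0,     vec4 1 0 0 i);
      (vec4 0 1 (-1) 0,  vec4 1 0 0 1);
      (vec4 0 1 (- i) 0, vec4 1 0 0 (- i));
      (vec4 0 1 0 1,     vec4 1 0 1 0);
      (vec4 1 0 0 0,     vec4 0 1 0 0);
      (vec4 0 1 0 i,     vec4 1 0 (- i) 0);
      (vec4 0 1 0 (-1),  vec4 1 0 (-1) 0)].

Definition ten_span (R : realType) (j : 'I_10) : {vspace 'rV[R[i]]_4} :=
  let pq := nth (0, 0) (spanning_points R) j in (<[pq.1]> + <[pq.2]>)%VS.

Lemma vec4_comb_eq (F : fieldType) (a b : F) (p0 p1 p2 p3 q0 q1 q2 q3 : F) :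
  a *: vec4 p0 p1 p2 p3 + b *: vec4 q0 q1 q2 q3 =
  vec4 (a * p0 + b * q0) (a * p1 + b * q1) (a * p2 + b * q2) (a * p3 + b * q3).
Proof.
apply/rowP => k; rewrite !mxE.
by case: k => -[|[|[|[|k]]]].
Qed.

Lemma vec4_inj (F : fieldType) (p0 p1 p2 p3 q0 q1 q2 q3 : F) :
  vec4 p0 p1 p2 p3 = vec4 q0 q1 q2 q3 ->
  [/\ p0 = q0, p1 = q1, p2 = q2 & p3 = q3].
Proof.
move=> /rowP e; move: (e 0) (e 1) (e 2%:R) (e 3%:R).
by rewrite !mxE.
Qed.

Lemma dim_span2 (F : fieldType) (p q : 'rV[F]_4) :
  (forall a b, a *: p + b *: q = 0 -> a = 0 /\ b = 0) ->
  \dim (<[p]> + <[q]>) = 2%N.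
Proof.
move=> free_pq.
have p0 : p != 0.
  apply/eqP => p0; have [] := free_pq 1 0; last by move/eqP; rewrite oner_eq0.
  by rewrite p0 scaler0 scale0r addr0.
have q0 : q != 0.
  apply/eqP => q0; have [] := free_pq 0 1; last by move=> _ /eqP; rewrite oner_eq0.
  by rewrite q0 scaler0 scale0r addr0.
rewrite dimv_disjoint_sum ?dim_vline ?p0 ?q0 //.
apply/eqP; rewrite -subv0; apply/subvP => u; rewrite memv_cap.
case/andP=> /vlineP[a ->] /vlineP[b e].
have [|-> _] := free_pq a (- b); last by rewrite scale0r mem0v.
by rewrite e scaleNr subrr.
Qed.

Lemma cap_span2 (F : fieldType) (p q p' q' : 'rV[F]_4) :
  (forall a b c d, a *: p + b *: q = c *: p' + d *: q' -> a = 0 /\ b = 0) ->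
  ((<[p]> + <[q]>) :&: (<[p']> + <[q']>) == 0)%VS.
Proof.
move=> h; rewrite -subv0; apply/subvP => u; rewrite memv_cap.
case/andP=> /memv_addP[_ /vlineP[a ->] [_ /vlineP[b ->] ->]].
case/memv_addP=> _ /vlineP[c ->] [_ /vlineP[d ->] /h[-> ->]].
by rewrite !scale0r addr0 mem0v.
Qed.

Lemma vec4_0 (F : fieldType) : vec4 0 0 0 0 = 0 :> 'rV[F]_4.
Proof. apply/rowP => k; rewrite !mxE.
by case: k => -[|[|[|[|k]]]]. Qed.

Local Notation Re := (@complex.Re _).
Local Notation Im := (@complex.Im _).

Lemma complex_eqP (R : realType) (x y : R[i]) :
  x = y <-> Re x = Re y /\ Im x = Im y.
Proof. by case: x y => [a b] [c d]; split=> [[-> ->]|[/= -> ->]]. Qed.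

Lemma complex_partsE (R : realType) :
  ((forall x : R[i], (Re (x * 'i%C) = - Im x)%R) *
   (forall x : R[i], (Im (x * 'i%C) = Re x)%R) *
   (forall x y : R[i], (Re (x + y) = Re x + Re y)%R) *
   (forall x y : R[i], (Im (x + y) = Im x + Im y)%R) *
   (forall x : R[i], (Re (- x) = - Re x)%R) *
   (forall x : R[i], (Im (- x) = - Im x)%R) *
   (Re (0 : R[i]) = 0)%R * (Im (0 : R[i]) = 0)%R)%type.
Proof.
do !split.
- exact: ReiNIm.
- exact: ImiRe.
- by case=> ? ? [? ?].
- by case=> ? ? [? ?].
- by case.
- by case.
Qed.

Ltac solve_complex_coords :=
  rewrite !vec4_comb_eq -?vec4_0 => /vec4_inj [];
  rewrite ?mulr0 ?mulr1 ?mulrN ?mulr1 ?mulr0 ?oppr0 ?addr0 ?add0r;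
  rewrite !complex_eqP ?complex_partsE;
  repeat match goal with |- context [Re ?x] => is_var x;
    generalize (Re x) (Im x); clear x; intros ? ? end;
  move=> [? ?] [? ?] [? ?] [? ?]; subst;
  repeat match goal with H : ?x = ?x |- _ => clear H end;
  (do !split); first [assumption | lra].

Lemma dim_ten_span (R : realType) (j : 'I_10) : \dim (ten_span R j) == 2%N.
Proof.
apply/eqP/dim_span2 => a b.
case: j => -[|[|[|[|[|[|[|[|[|[|//]]]]]]]]]] /= _; solve_complex_coords.
Qed.

Definition ten_line (R : realType) (j : 'I_10) : line R[i] :=
  exist _ (ten_span R j) (dim_ten_span R j).

Definition ten_lines (R : realType) : set (line R[i]) := range (@ten_line R).

Arguments ten_lines : clear implicits.

Lemma ten_lines_skew (R : realType) (j k : 'I_10) :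
  j != k -> skew (ten_line R j) (ten_line R k).
Proof.
wlog jk : j k / (j < k)%N => [hw jk|_].
  case: (ltngtP j k) => [jk'|kj|/val_inj e]; last by rewrite e eqxx in jk.
    exact: hw.
  by rewrite skewC; apply: hw; rewrite 1?eq_sym.
apply: cap_span2 => a b c d.
case: j jk => -[|[|[|[|[|[|[|[|[|[|j]]]]]]]]]] jlt; try discriminate jlt.
all: case: k => -[|[|[|[|[|[|[|[|[|[|k]]]]]]]]]] klt jk;
  try discriminate klt; try discriminate jk.
all: rewrite /=; solve_complex_coords.
Qed.

(* Main.v *)
(* L_0 is the graph of the slope oo and the nine other lines are the graphs
   {(v, v A)} of A = 0 and of the eight matrices +-1, +-I, +-J, +-K of the
   quaternion group.  In the coordinates v, the projection from the graph of A
   to the graph of A'' through the graph of A' is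
   (A - A') (A'' - A')^-1.  Differences of two elements of {0} u Q_8 are, up to
   scalars, rotations of the cube with axes I, J, K, so that they permute its
   four diagonals +-I +-J +-K; a matrix is determined up to a scalar by the
   permutation, which embeds every automorphism group into S_4.  Conversely,
   projecting through L_0 is the identity in the coordinates v, so that every
   difference A - A' occurs in a loop, and the differences of two of I, J, K up
   to sign are the half-turns exchanging two diagonals: all transpositions
   occur. *)
Require Import Defs.
From HB Require Import structures.
From mathcomp Require Import all_boot all_fingroup all_algebra.
From mathcomp Require Import boolp classical_sets reals complex ring.

Set Implicit Arguments.
Unset Strict Implicit.
Unset Printing Implicit Defensive.

Import GRing.Theory Num.Theory.
Local Open Scope ring_scope.

Lemma ord2E n (n2 : (n < 2)%N) : Ordinal n2 = if n == 0%N then 0 else 1.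
Proof. by apply/val_inj; case: n n2 => [|[|n]]. Qed.

Lemma lift0_ord2 : lift ord0 ord0 = 1 :> 'I_2.
Proof. exact: val_inj. Qed.

Lemma ord0_0 n : ord0 = 0 :> 'I_n.+1.
Proof. exact: val_inj. Qed.

(** * Quaternions as 2 x 2 matrices, and the diagonals of the cube *)

Section Quaternions.
Variables (F : numFieldType) (i : F).
Hypothesis sqr_i : i * i = -1.

(* [a + b I + c J + d K] for I = diag(i, -i), J = [[0, 1], [-1, 0]], K = I J. *)
Definition quat (a b c d : F) : 'M[F]_2 :=
  \matrix_(r, s) (nth [::] [:: [:: a + b * i; c + d * i]; [:: d * i - c; a - b * i]] r)`_s.

Lemma quatM a b c d a' b' c' d' :
  quat a b c d * quat a' b' c' d' =
  quat (a * a' - b * b' - c * c' - d * d') (a * b' + b * a' + c * d' - d * c')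
       (a * c' - b * d' + c * a' + d * b') (a * d' + b * c' - c * b' + d * a').
Proof.
apply/matrixP => -[[|[|//]] ?] -[[|[|//]] ?];
  rewrite !mxE !big_ord_recl big_ord0 !mxE /=.
all: by ring: sqr_i.
Qed.

Lemma quatD a b c d a' b' c' d' :
  quat a b c d + quat a' b' c' d' = quat (a + a') (b + b') (c + c') (d + d').
Proof.
by apply/matrixP => -[[|[|//]] ?] -[[|[|//]] ?]; rewrite !mxE /=; ring.
Qed.

Lemma quatZ k a b c d : k *: quat a b c d = quat (k * a) (k * b) (k * c) (k * d).
Proof.
by apply/matrixP => -[[|[|//]] ?] -[[|[|//]] ?]; rewrite !mxE /=; ring.
Qed.

Lemma quatN a b c d : - quat a b c d = quat (- a) (- b) (- c) (- d).
Proof. by rewrite -scaleN1r quatZ !mulN1r. Qed.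

Lemma quat_scalar a : quat a 0 0 0 = a%:M.
Proof.
by apply/matrixP => -[[|[|//]] ?] -[[|[|//]] ?]; rewrite !mxE /=; ring.
Qed.

(* Oriented so that they sum to zero: the sign in [diag_perm] is then the same
   for the four diagonals, and is the signature. *)
Definition cube_diagonal (a : 'I_4) : 'M[F]_2 :=
  nth 0 [:: quat 0 1 1 1; quat 0 1 (-1) (-1); quat 0 (-1) 1 (-1);
            quat 0 (-1) (-1) 1] a.

Lemma cube_diagonal_sqr a : cube_diagonal a * cube_diagonal a = (-3)%:M.
Proof.
case: a => [[|[|[|[|//]]]] ?]; rewrite /cube_diagonal /=.
all: rewrite !quatM -quat_scalar; congr quat; ring.
Qed.

(** For pure quaternions [u v + v u] is minus twice the inner product of the vectors, and two
    distinct diagonals have inner product -1. *)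
Lemma cube_diagonal_anticomm a b :
  a != b -> cube_diagonal a * cube_diagonal b + cube_diagonal b * cube_diagonal a = 2%:M.
Proof.
case: a b => [[|[|[|[|//]]]] ?] [[|[|[|[|//]]]] ?] // _; rewrite /cube_diagonal /=.
all: rewrite !quatM quatD -quat_scalar; congr quat; ring.
Qed.

Lemma cube_diagonal_inj (s t : bool) a b :
  (-1) ^+ s *: cube_diagonal a = (-1) ^+ t *: cube_diagonal b -> a = b.
Proof.
move=> e; apply/eqP/negP => /negP ab.
have {e} [c cc e] : exists2 c : F, c * c = 1 & cube_diagonal a = c *: cube_diagonal b.
  exists ((-1) ^+ s * (-1) ^+ t).
    by rewrite mulrACA -!expr2 !sqrr_sign mulr1.
  by rewrite -scalerA -e scalerA -expr2 sqrr_sign scale1r.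
have := cube_diagonal_anticomm ab.
rewrite e -scalerAl -scalerAr cube_diagonal_sqr -mulr2n scale_scalar_mx -raddfMn.
move=> /matrixP/(_ 0 0); rewrite !mxE eqxx !mulr1n => h.
(* Squaring [-6 c = 2] removes the unknown sign [c]. *)
have : 36 == 4 :> F.
  apply/eqP; transitivity ((c * -3 *+ 2) * (c * -3 *+ 2)); first by ring: cc.
  by rewrite h; ring.
by rewrite eqr_nat.
Qed.

(** * Matrices permuting the four diagonals *)

(** Conjugation [d -> M^-1 d M] takes diagonal [a] to diagonal [s a] up to sign; in the exponent,
    [s] stands for its parity. *)
Definition diag_perm (M : 'M[F]_2) (s : 'S_4) : Prop :=
  M \in unitmx /\
  forall a, cube_diagonal a * M = (-1) ^+ s *: (M * cube_diagonal (s a)).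

Lemma diag_permM M N s t :
  diag_perm M s -> diag_perm N t -> diag_perm (M * N) (s * t)%g.
Proof.
move=> [uM hM] [uN hN]; split=> [|a]; first by rewrite unitmx_mul uM.
rewrite mulrA hM -scalerAl -[M * _ * N]mulrA hN -scalerAr scalerA mulrA permM.
by rewrite odd_permM signr_addb.
Qed.

Lemma diag_permZ c M s : c != 0 -> diag_perm M s -> diag_perm (c *: M) s.
Proof.
move=> c0 [uM hM]; split=> [|a]; first by rewrite unitmxZ // unitfE.
by rewrite -scalerAr hM -scalerAl !scalerA mulrC.
Qed.

Lemma diag_perm1 : diag_perm 1 1%g.
Proof.
split=> [|a]; first exact: unitmx1.
by rewrite mul1r mulr1 odd_perm1 scale1r perm1.
Qed.

Lemma diag_permV M s : diag_perm M s -> diag_perm M^-1 s^-1%g.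
Proof.
move=> [uM hM]; split=> [|a]; first by rewrite unitmx_inv.
apply: (mulrI uM); apply: (mulIr uM).
rewrite mulrA mulrVK // -scalerAr mulVKr // -scalerAl.
by rewrite hM odd_permV scalerA -expr2 sqrr_sign scale1r permKV.
Qed.

Lemma diag_perm_perm_unique M s t : diag_perm M s -> diag_perm M t -> s = t.
Proof.
move=> [uM hs] [_ ht]; apply/permP => a; apply: (@cube_diagonal_inj s t).
by apply: (mulrI uM); rewrite -!scalerAr -hs -ht.
Qed.

Lemma i_neq0 : i != 0.
Proof.
by apply/eqP => i0; move/eqP: sqr_i; rewrite i0 mul0r eq_sym oppr_eq0 oner_eq0.
Qed.

(** Sums of two diagonals give [2 I] and [2 J]. Commuting with the diagonal matrix [2 I] kills the
    off-diagonal entries of [M], and commuting with [2 J] then equates the diagonal ones. *)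
Lemma cube_diagonal_centralizer M :
  (forall a, cube_diagonal a * M = M * cube_diagonal a) -> M = (M 0 0)%:M.
Proof.
move=> cM.
have cI : quat 0 2 0 0 * M = M * quat 0 2 0 0.
  have -> : quat 0 2 0 0 = cube_diagonal 0 + cube_diagonal 1.
    by rewrite quatD; congr quat; ring.
  by rewrite mulrDl mulrDr !cM.
have cJ : quat 0 0 2 0 * M = M * quat 0 0 2 0.
  have -> : quat 0 0 2 0 = cube_diagonal 0 + cube_diagonal 2.
    by rewrite quatD; congr quat; ring.
  by rewrite mulrDl mulrDr !cM.
have i4 : 4 * i != 0 by rewrite mulf_neq0 ?i_neq0 ?pnatr_eq0.
have two : 2 != 0 :> F by rewrite pnatr_eq0.
move/matrixP: cI => cI; move/matrixP/(_ 0 1): cJ.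
move: (cI 0 1) (cI 1 0).
rewrite !mxE !big_ord_recl !big_ord0 !mxE /=.
rewrite lift0_ord2 ord0_0.
move=> /eqP; rewrite -subr_eq0 => /eqP h01.
move=> /eqP; rewrite -subr_eq0 => /eqP h10.
move=> /eqP; rewrite -subr_eq0 => /eqP h11.
have M01 : M 0 1 = 0 by apply: (mulfI i4); rewrite mulr0 -[RHS]h01; ring.
have M10 : M 1 0 = 0.
  by apply: (mulfI i4); rewrite mulr0; apply: oppr_inj; rewrite oppr0 -[RHS]h10; ring.
have M11 : M 1 1 = M 0 0.
  by apply: (mulfI two); apply/eqP; rewrite -subr_eq0 -h11 M01; apply/eqP; ring.
by apply/matrixP => -[[|[|//]] p] -[[|[|//]] q]; rewrite !ord2E mxE.
Qed.

(** The quotient [M / N] induces the identity permutation, so it commutes with every diagonal and is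
    a scalar. *)
Lemma diag_perm_unique M N s :
  diag_perm M s -> diag_perm N s -> exists2 c, c != 0 & M = c *: N.
Proof.
move=> oM oN; have [uMN cMN] := diag_permM oM (diag_permV oN).
have {}cMN : M / N = ((M / N) 0 0)%:M.
  apply: cube_diagonal_centralizer => a.
  by rewrite cMN mulgV odd_perm1 scale1r perm1.
exists ((M / N) 0 0); last first.
  by rewrite -mul_scalar_mx -cMN -[_ *m _]/(M / N * N) divrK //; case: oN.
apply: contraL uMN => /eqP e; rewrite cMN e.
by rewrite unitmxE raddf0 det0 unitr0.
Qed.

(** Conjugation by a pure quaternion is the half-turn about it. About the difference of diagonals
    [a] and [b], it takes each of the two to minus the other and negates the remaining ones, which
    are orthogonal to the axis. The common sign -1 is the signature of a transposition. *)
Lemma diag_perm_tperm a b :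
  a != b -> diag_perm (cube_diagonal a - cube_diagonal b) (tperm a b).
Proof.
move=> ab; have ba : b != a by rewrite eq_sym.
split=> [|c].
  have e : (cube_diagonal a - cube_diagonal b) * (cube_diagonal a - cube_diagonal b) =
           (-8)%:M.
    rewrite mulrBl !mulrBr !cube_diagonal_sqr opprB addrACA -opprD.
    rewrite cube_diagonal_anticomm // -raddfD -raddfB /=.
    by congr (_%:M); ring.
  have : (cube_diagonal a - cube_diagonal b) *m
         ((- 8^-1) *: (cube_diagonal a - cube_diagonal b)) = 1%:M.
    rewrite -scalemxAr -[_ *m _]/(_ * _) e scale_scalar_mx mulrNN mulVf //.
    by rewrite pnatr_eq0.
  by case/mulmx1_unit.
rewrite odd_tperm ab expr1 scaleN1r mulrBl mulrBr opprB.
case: tpermP => [->|->|/eqP ca /eqP cb].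
- by rewrite !cube_diagonal_sqr.
- by rewrite !cube_diagonal_sqr.
- have /(canRL (addrK _)) -> := cube_diagonal_anticomm ca.
  have /(canRL (addrK _)) -> := cube_diagonal_anticomm cb.
  by rewrite opprB addrC addrA subrK.
Qed.

(** * Differences of slopes permute the diagonals *)

Definition octahedral (M : 'M[F]_2) : Prop := exists s, diag_perm M s.

Lemma octahedralM M N : octahedral M -> octahedral N -> octahedral (M * N).
Proof. by move=> [s oM] [t oN]; exists (s * t)%g; apply: diag_permM. Qed.

Lemma octahedralZ c M : c != 0 -> octahedral M -> octahedral (c *: M).
Proof. by move=> c0 [s oM]; exists s; apply: diag_permZ. Qed.

Lemma octahedralN M : octahedral M -> octahedral (- M).
Proof. by rewrite -scaleN1r; apply: octahedralZ; rewrite oppr_eq0 oner_eq0. Qed.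

(** These are the axes through midpoints of opposite edges of the cube; each is half a difference of
    two diagonals, up to sign. *)
Lemma octahedral_edges (b : bool) :
  [/\ octahedral (quat 0 0 1 ((-1) ^+ b)), octahedral (quat 0 ((-1) ^+ b) 0 1)
    & octahedral (quat 0 1 ((-1) ^+ b) 0)].
Proof.
have edge c k l (kl : k != l) : c != 0 ->
    octahedral (c *: (cube_diagonal k - cube_diagonal l)).
  by move=> c0; apply: octahedralZ => //; exists (tperm k l); apply: diag_perm_tperm.
have h0 : 2^-1 != 0 :> F by rewrite invr_eq0 pnatr_eq0.
have Nh0 : - 2^-1 != 0 :> F by rewrite oppr_eq0.
case: b; rewrite /= ?expr0 ?expr1; split.
all: [> move: (edge 2^-1 2 3 isT h0) | move: (edge (- 2^-1) 1 3 isT Nh0)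
      | move: (edge 2^-1 1 2 isT h0) | move: (edge 2^-1 0 1 isT h0)
      | move: (edge 2^-1 0 2 isT h0) | move: (edge 2^-1 0 3 isT h0)].
all: by rewrite quatN quatD quatZ; congr (octahedral (quat _ _ _ _)); field.
Qed.

(** Half-turns about the perpendicular axes [J + K] and [J - K] compose to the half-turn about [I]:
    their product is [-2 I]. The other two cases follow cyclically. *)
Lemma octahedral_units :
  [/\ octahedral (quat 0 1 0 0), octahedral (quat 0 0 1 0) & octahedral (quat 0 0 0 1)].
Proof.
have [+ + +] := octahedral_edges false; have [+ + +] := octahedral_edges true.
rewrite /= ?expr0 ?expr1 => jk' ki' ij' jk ki ij.
have h0 : - 2^-1 != 0 :> F by rewrite oppr_eq0 invr_eq0 pnatr_eq0.
split; [move: (octahedralM jk jk') | move: (octahedralM ki ki') | move: (octahedralM ij ij')].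
all: move/(octahedralZ h0); rewrite quatM quatZ.
all: by congr (octahedral (quat _ _ _ _)); field.
Qed.

(** Quarter-turns: [1 + I = - (J + K) J] is a product of half-turns about axes at 45 degrees, up to
    sign, and similarly for the others. *)
Lemma octahedral_real_edges (b : bool) :
  [/\ octahedral (quat 1 ((-1) ^+ b) 0 0), octahedral (quat 1 0 ((-1) ^+ b) 0)
    & octahedral (quat 1 0 0 ((-1) ^+ b))].
Proof.
have [jk ki ij] := octahedral_edges b; have [oi oj ok] := octahedral_units.
split; [move: (octahedralM jk oj) | move: (octahedralM ki ok) | move: (octahedralM ij oi)].
all: move/octahedralN; rewrite quatM quatN.
all: by congr (octahedral (quat _ _ _ _)); ring.
Qed.

Definition basis_quat (m : 'I_4) : 'M[F]_2 :=
  nth 0 [:: quat 1 0 0 0; quat 0 1 0 0; quat 0 0 1 0; quat 0 0 0 1] m.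

Lemma octahedral_basis m : octahedral (basis_quat m).
Proof.
have [oi oj ok] := octahedral_units.
case: m => [[|[|[|[|//]]]] ?] //; rewrite /basis_quat /= quat_scalar.
by exists 1%g; apply: diag_perm1.
Qed.

Lemma octahedral_basisD m n (b : bool) :
  m != n -> octahedral (basis_quat m + (-1) ^+ b *: basis_quat n).
Proof.
wlog mn : m n / (m < n)%N => [hw|_].
  case: (ltngtP m n) => [mn|nm|/val_inj ->]; last by rewrite eqxx.
    exact: hw.
  move=> m_n; have b0 : (-1) ^+ b != 0 :> F by rewrite signr_eq0.
  have nm' : n != m by rewrite eq_sym.
  have := octahedralZ b0 (hw n m nm nm').
  by rewrite scalerDr scalerA -expr2 sqrr_sign scale1r addrC.
have [jk ki ij] := octahedral_edges b; have [ri rj rk] := octahedral_real_edges b.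
have b0 : (-1) ^+ b != 0 :> F by rewrite signr_eq0.
(* The axis in the plane of [I] and [K] comes with its sign on [I]; rescaling moves the sign to
   [K]. *)
have := octahedralZ b0 ki.
case: m n mn => [[|[|[|[|//]]]] ?] [[|[|[|[|//]]]] ?] //= _; rewrite /basis_quat /=.
all: rewrite !quatZ quatD !(mulr0, mulr1, addr0, add0r) //.
by rewrite -expr2 sqrr_sign.
Qed.

Definition slope (x : option (bool * 'I_4)) : 'M[F]_2 :=
  if x is Some (b, m) then (-1) ^+ b *: basis_quat m else 0.

(** If both slopes are nonzero, either they are opposite and the difference is twice a signed unit,
    or they come from two different basis units. *)
Lemma octahedral_slopeB x y : x != y -> octahedral (slope x - slope y).
Proof.
have oS (b : bool) m : octahedral ((-1) ^+ b *: basis_quat m).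
  by apply: octahedralZ (octahedral_basis m); rewrite signr_eq0.
case: x y => [[b m]|] [[c n]|] //= xy.
- have [mn|mn] := eqVneq m n.
    move: xy; rewrite -{n}mn; case: b c => [] [] /=; rewrite ?eqxx // => _.
    + rewrite expr1 expr0 scaleN1r scale1r -opprD; apply: octahedralN.
      by rewrite -mulr2n -scaler_nat; apply: octahedralZ (octahedral_basis m); rewrite pnatr_eq0.
    + rewrite expr1 expr0 scaleN1r scale1r opprK.
      by rewrite -mulr2n -scaler_nat; apply: octahedralZ (octahedral_basis m); rewrite pnatr_eq0.
  have b0 : (-1) ^+ b != 0 :> F by rewrite signr_eq0.
  (* Factoring [(-1) ^+ b] out of the difference leaves the sign [- (-1) ^+ (b (+) c)] on the second
     unit. *)
  have := octahedralZ b0 (octahedral_basisD (~~ (b (+) c)) mn).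
  rewrite scalerDr scalerA -signr_addb -scaleNr.
  congr (octahedral (_ + _ *: _)).
  by case: b c {xy b0} => [] []; rewrite /= ?expr0 ?expr1 ?opprK.
- by rewrite subr0.
- by rewrite sub0r; apply: octahedralN.
Qed.

(** Two diagonals agree in one coordinate and are opposite in the two others, so their difference is
    twice a signed sum of two units. *)
Lemma cube_diagonalB_slope k l :
  k != l -> exists x y, cube_diagonal k - cube_diagonal l = 2 *: (slope x - slope y).
Proof.
wlog kl : k l / (k < l)%N => [hw|_].
  case: (ltngtP k l) => [kl|lk|/val_inj ->]; last by rewrite eqxx.
    exact: hw.
  move=> _; have [|x [y e]] := hw l k lk; first by rewrite neq_ltn lk.
  by exists y, x; rewrite -opprB e -scalerN opprB.
pose S (b : bool) (m : nat) := Some (b, inord m : 'I_4).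
have SE (b : bool) m : (m < 4)%N -> slope (S b m) = (-1) ^+ b *:
   nth 0 [:: quat 1 0 0 0; quat 0 1 0 0; quat 0 0 1 0; quat 0 0 0 1] m.
  by move=> m4; rewrite /slope /= /basis_quat inordK.
case: k l kl => [[|[|[|[|//]]]] ?] [[|[|[|[|//]]]] ?] // _.
all: [> exists (S false 2), (S true 3) | exists (S false 1), (S true 3)
      | exists (S false 1), (S true 2) | exists (S false 1), (S false 2)
      | exists (S false 1), (S false 3) | exists (S false 2), (S false 3)].
all: rewrite !SE // /cube_diagonal /= !(quatZ, quatN, quatD).
all: by congr quat; ring.
Qed.

Lemma diag_perm_slope k l :
  k != l -> exists x y, diag_perm (slope x - slope y) (tperm k l).
Proof.
move=> kl; have [x [y e]] := cube_diagonalB_slope kl; exists x, y.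
have two : 2 != 0 :> F by rewrite pnatr_eq0.
have := diag_permZ (invr_neq0 two) (diag_perm_tperm kl).
by rewrite e scalerK.
Qed.

End Quaternions.

(** * Lines as graphs, in coordinates *)

(* [None] is the slope oo of L_0, [Some None] the slope 0 of L_7, and
   [Some (Some (b, m))] the slope (-1)^b times the m-th of 1, I, J, K. *)
Definition label := option (option (bool * 'I_4)).

Section Frames.
Variables (F : numFieldType) (i : F).
Hypothesis sqr_i : i * i = -1.

Definition frame (x : label) : 'M[F]_(2, 4) :=
  if x is Some t then row_mx (1%:M : 'M_2) (slope i t) else row_mx (0 : 'M_2) (1%:M : 'M_2).

Definition coframe (x : label) : 'M[F]_(4, 2) :=
  if x is Some t then col_mx (- slope i t) (1%:M : 'M_2) else col_mx (1%:M : 'M_2) (0 : 'M_2).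

(** The map from line [x] to the quotient of the whole space by line [y], in coordinates. It is
    invertible when the lines are skew. *)
Definition cross (x y : label) : 'M[F]_2 := frame x *m coframe y.

Lemma cross_slopes s t : cross (Some s) (Some t) = slope i s - slope i t.
Proof. by rewrite /cross (@mul_row_col _ _ 2 2 2) mul1mx mulmx1 addrC. Qed.

Lemma cross_infl t : cross None (Some t) = 1.
Proof. by rewrite /cross (@mul_row_col _ _ 2 2 2) mul0mx mulmx1 add0r. Qed.

Lemma cross_infr t : cross (Some t) None = 1.
Proof. by rewrite /cross (@mul_row_col _ _ 2 2 2) mulmx1 mulmx0 addr0. Qed.

Lemma cross_diag x : cross x x = 0.
Proof.
case: x => [t|]; first by rewrite cross_slopes subrr.
by rewrite /cross (@mul_row_col _ _ 2 2 2) mul0mx mulmx0 addr0.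
Qed.

Lemma octahedral_cross x y : x != y -> octahedral i (cross x y).
Proof.
have o1 : octahedral i 1 by exists 1%g; apply: diag_perm1.
case: x y => [s|] [t|] //= xy; rewrite ?cross_infl ?cross_infr //.
by rewrite cross_slopes; apply: octahedral_slopeB.
Qed.

Lemma cross_unit x y : x != y -> cross x y \in unitmx.
Proof. by move=> /octahedral_cross[s []]. Qed.

Lemma frame_inj x (u v : 'rV[F]_2) : u *m frame x = v *m frame x -> u = v.
Proof.
have [y xy] : exists y, x != y by case: x => [t|]; [exists None|exists (Some None)].
move=> e; apply: (can_inj (mulmxK (cross_unit xy))).
by rewrite /cross !mulmxA e.
Qed.

Lemma coframe_eq0 x (w : 'rV[F]_4) :
  w *m coframe x = 0 <-> exists v, w = v *m frame x.
Proof.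
split=> [|[v ->]]; last by rewrite -mulmxA -/(cross x x) cross_diag mulmx0.
rewrite -[w](@hsubmxK _ 1 2 2).
case: x => [t|]; rewrite (@mul_row_col _ _ 2 2 2) !(mulmx0, mulmx1, mulmxN) ?addr0 /=.
  move=> /eqP; rewrite addrC subr_eq0 => /eqP ->.
  by eexists; rewrite (@mul_mx_row _ _ _ 2 2) mulmx1.
by move=> ->; eexists; rewrite (@mul_mx_row _ _ _ 2 2) mulmx1 mulmx0.
Qed.

(* The rows of [frame x] span the line, which is the kernel of [coframe x]. *)
Definition framed (L : line F) (x : label) : Prop :=
  forall w, (w \in val L) = (w *m coframe x == 0).

Lemma framedP (L : line F) x w :
  framed L x -> reflect (exists v, w = v *m frame x) (w \in val L).
Proof.
by move=> Lx; rewrite Lx; apply: (iffP eqP); rewrite coframe_eq0.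
Qed.

Lemma framed_skew (L M : line F) x y :
  framed L x -> framed M y -> Defs.skew L M = (x != y).
Proof.
move=> Lx My; apply/idP/idP => [sk|xy].
  apply: contraTneq sk => xy; rewrite xy in Lx.
  have -> : M = L by apply/val_inj/vspaceP => w; rewrite Lx My.
  by rewrite /Defs.skew capvv -dimv_eq0 (eqP (valP L)).
rewrite /Defs.skew -subv0; apply/subvP => w.
rewrite memv_cap => /andP[/(framedP _ Lx)[v ->]]; rewrite My -mulmxA => /eqP.
move=> /(canRL (mulmxK (cross_unit xy))) ->.
by rewrite mul0mx mul0mx mem0v.
Qed.

Lemma point_vline (L : line F) x (P : point_on L) :
  framed L x -> exists2 v, v != 0 & val P = <[v *m frame x]>%VS.
Proof.
move=> Lx; pose w := vpick (val P).
have w0 : w != 0 by rewrite vpick0 -dimv_eq0 dim_point.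
have Pw : val P = <[w]>%VS.
  by apply/esym/eqP; rewrite eqEdim -memvE memv_pick dim_point dim_vline w0.
have : w \in val L by rewrite memvE -Pw point_sub.
case/(framedP _ Lx) => v wv; exists v; last by rewrite Pw wv.
by apply: contraNneq w0; rewrite wv => ->; rewrite mul0mx.
Qed.

Lemma vline_point (L : line F) x (v : 'rV[F]_2) :
  framed L x -> v != 0 -> exists P : point_on L, val P = <[v *m frame x]>%VS.
Proof.
move=> Lx v0.
have h : (\dim <[v *m frame x]> == 1)%N && (<[v *m frame x]> <= val L)%VS.
  rewrite -memvE; apply/andP; split; last by apply/framedP; [exact: Lx|exists v].
  rewrite dim_vline eqb1; apply: contraNneq v0 => e.
  by apply/eqP/(@frame_inj x); rewrite e mul0mx.
by exists (exist _ <[v *m frame x]>%VS h).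
Qed.

(** * Maps between lines as matrices up to scalars *)

Definition acts (L M : line F) (x y : label) (f : point_on L -> point_on M)
    (T : 'M[F]_2) : Prop :=
  forall v P, val P = <[v *m frame x]>%VS -> val (f P) = <[v *m T *m frame y]>%VS.

Lemma acts_id (L : line F) x : acts x x (@id (point_on L)) 1.
Proof. by move=> v P ->; rewrite mulmx1. Qed.

Lemma acts_comp (L M N : line F) x y z (f : point_on L -> point_on M)
    (g : point_on M -> point_on N) T U :
  acts x y f T -> acts y z g U -> acts x z (g \o f) (T * U).
Proof. by move=> fT gU v P /fT/gU ->; rewrite mulmxA. Qed.

Lemma vlineZ (V : vectType F) c (w : V) : c != 0 -> <[c *: w]>%VS = <[w]>%VS.
Proof.
move=> c0; apply/eqP; rewrite eqEsubv -!memvE memvZ ?memv_line //=.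
by rewrite -[X in X \in _](scalerK c0) memvZ // memv_line.
Qed.

Lemma actsZ (L M : line F) x y (f : point_on L -> point_on M) T c :
  c != 0 -> acts x y f T -> acts x y f (c *: T).
Proof.
by move=> c0 fT v P /fT ->; rewrite -scalemxAr -scalemxAl vlineZ.
Qed.

Lemma acts_eq (L M : line F) x y (f g : point_on L -> point_on M) T :
  framed L x -> acts x y f T -> acts x y g T -> f = g.
Proof.
move=> Lx fT gT; apply/funext => P; apply/val_inj.
by have [v _ e] := point_vline P Lx; rewrite (fT _ _ e) (gT _ _ e).
Qed.

(** A vector [u] of [L''] lies in the plane of [P = <p>] and [L'] as soon as [u - p] lies on [L'],
    that is, as soon as [coframe y] takes [u] and [p] to the same value. For coordinates [v'] of [u]
    and [v] of [p] this reads [v' * cross z y = v * cross x y]. *)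
Lemma acts_proj (L L' L'' : line F) x y z (sk : Defs.skew L L') (sk' : Defs.skew L' L'') :
  framed L x -> framed L' y -> framed L'' z ->
  acts x z (proj sk sk') (cross x y * (cross z y)^-1).
Proof.
move=> Lx Ly Lz v P Pv.
have xy : x != y by rewrite -(framed_skew Lx Ly).
have zy : z != y by rewrite eq_sym -(framed_skew Ly Lz).
set u := v *m _ *m _.
have v0 : v != 0.
  by apply/eqP => v0; have := dim_point P; rewrite Pv v0 mul0mx dim_vline eqxx.
have u0 : u != 0.
  apply: contraNneq v0; rewrite /u => h.
  have {}h : v *m (cross x y * (cross z y)^-1) = 0.
    by apply: (@frame_inj z); rewrite h mul0mx.
  have uT : cross x y * (cross z y)^-1 \in unitmx.
    by rewrite unitmx_mul unitmx_inv !cross_unit.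
  by apply/eqP/(can_inj (mulmxK uT)); rewrite h mul0mx.
apply/esym/eqP; rewrite eqEdim dim_point dim_vline u0 andbT -memvE memv_cap.
apply/andP; split; last by apply/(framedP _ Lz); exists (v *m (cross x y * (cross z y)^-1)).
rewrite -[u](subrK (v *m frame x)) addrC memv_add ?Pv ?memv_line //.
rewrite Ly mulmxBl subr_eq0 /u -[_ *m frame z *m _]mulmxA -[_ *m frame x *m _]mulmxA.
rewrite -/(cross x y) -/(cross z y) -[v *m _ *m _]mulmxA.
have -> // : cross x y / cross z y *m cross z y = cross x y.
by apply: divrK; apply: cross_unit.
Qed.

Lemma eigen_scalar (N : 'M[F]_2) :
  (forall v : 'rV_2, exists c, v *m N = c *: v) -> N = (N 0 0)%:M.
Proof.
move=> hN.
have row2 (a b : F) : exists c,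
    a * N 0 0 + b * N 1 0 = c * a /\ a * N 0 1 + b * N 1 1 = c * b.
  have [c /rowP e] := hN (\row_k [:: a; b]`_k).
  exists c; move: (e 0) (e 1); rewrite !mxE !big_ord_recl !big_ord0 !mxE /= !addr0.
  by rewrite lift0_ord2.
have [c0 [_]] := row2 1 0; rewrite !(mul1r, mul0r, mulr0, addr0) => N01.
have [c1 [+ _]] := row2 0 1; rewrite !(mul1r, mul0r, mulr0, add0r) => N10.
have [c2 []] := row2 1 1; rewrite N01 N10 !(mul1r, mulr1, addr0, add0r) => N00 N11.
apply/matrixP => -[[|[|//]] p] -[[|[|//]] q]; rewrite !ord2E mxE //=.
by rewrite N11 N00.
Qed.

(** Every vector is an eigenvector of [T / U], which is therefore scalar. *)
Lemma acts_unique (L M : line F) x y (f : point_on L -> point_on M) T U :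
  framed L x -> T \in unitmx -> U \in unitmx ->
  acts x y f T -> acts x y f U -> exists2 c, c != 0 & T = c *: U.
Proof.
move=> Lx uT uU fT fU.
have hN : T / U = ((T / U) 0 0)%:M.
  apply: eigen_scalar => v; have [->|v0] := eqVneq v 0.
    by exists 0; rewrite mul0mx scaler0.
  have [P e] := vline_point Lx v0.
  have : v *m T *m frame y \in <[v *m U *m frame y]>%VS.
    by rewrite memvE -(fT v P e) -(fU v P e).
  case/vlineP => c; rewrite scalemxAl => /frame_inj h; exists c.
  by rewrite mulmxA h -scalemxAl mulmxK.
exists ((T / U) 0 0); last by rewrite -mul_scalar_mx -hN -[_ *m _]/(T / U * U) divrK.
have : T / U \in unitmx by rewrite unitmx_mul uT unitmx_inv.
apply: contraL => /eqP e; rewrite hN e.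
by rewrite unitmxE raddf0 det0 unitr0.
Qed.

Lemma acts_diag_perm_unique (L M : line F) x y (f : point_on L -> point_on M) T U s t :
  framed L x -> acts x y f T -> acts x y f U ->
  diag_perm i T s -> diag_perm i U t -> s = t.
Proof.
move=> Lx fT fU oT oU.
have [c c0 e] := acts_unique Lx oT.1 oU.1 fT fU.
by apply: diag_perm_perm_unique oT _ => //; rewrite e; apply: diag_permZ.
Qed.

End Frames.

(** * The ten lines and their slopes *)

(** The tables are read off the spanning points: those of [L_1], for instance, are the rows
    [(1, 0, i, 0)] and [(0, 1, 0, -i)] of the graph of [I]. *)
Definition line_index (x : label) : 'I_10 :=
  match x with
  | None => inord 0
  | Some None => inord 7
  | Some (Some (b, m)) =>
      inord (nth 0 (if b then [:: 9; 8; 2; 5] else [:: 6; 1; 4; 3]) m)%N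
  end.

Lemma line_index_surj j : exists x, line_index x = j.
Proof.
have -> : j = inord j by rewrite inord_val.
have S b (m : nat) : (m < 4)%N -> line_index (Some (Some (b, inord m))) =
    inord (nth 0 (if b then [:: 9; 8; 2; 5] else [:: 6; 1; 4; 3]) m)%N.
  by move=> m4; rewrite /= inordK.
case: j => [[|[|[|[|[|[|[|[|[|[|//]]]]]]]]]] ?].
- by exists None.
- by exists (Some (Some (false, inord 1))); rewrite S.
- by exists (Some (Some (true, inord 2))); rewrite S.
- by exists (Some (Some (false, inord 3))); rewrite S.
- by exists (Some (Some (false, inord 2))); rewrite S.
- by exists (Some (Some (true, inord 3))); rewrite S.
- by exists (Some (Some (false, inord 0))); rewrite S.
- by exists (Some None).
- by exists (Some (Some (true, inord 1))); rewrite S.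
- by exists (Some (Some (true, inord 0))); rewrite S.
Qed.

Section TenLines.
Variable R : realType.
Local Notation C := R[i].
Local Notation i := ('i%C : C).

Lemma sqr_iC : i * i = -1.
Proof. by rewrite -expr2 sqr_i. Qed.

Lemma mem_span2 (F : fieldType) (p q : 'rV[F]_4) (B : 'M[F]_(2, 4)) :
  (forall v, v *m B = v 0 0 *: q + v 0 1 *: p) ->
  forall w, reflect (exists v, w = v *m B) (w \in (<[p]> + <[q]>)%VS).
Proof.
move=> hB w; apply: (iffP memv_addP) => [[_ /vlineP[a ->] [_ /vlineP[b ->] ->]]|].
  exists (\row_k [:: b; a]`_k); rewrite hB !mxE /=; exact: addrC.
case=> v ->; exists (v 0 1 *: p); first by apply/vlineP; exists (v 0 1).
exists (v 0 0 *: q); first by apply/vlineP; exists (v 0 0).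
by rewrite hB addrC.
Qed.

(** For the eight lines of nonzero finite slope the second spanning point is the first row of the
    frame, hence the exchange. *)
Lemma mul_frame x (v : 'rV[C]_2) :
  let pq := nth (0, 0) (spanning_points R) (line_index x) in
  v *m frame i x = if x is Some (Some _) then v 0 0 *: pq.2 + v 0 1 *: pq.1
                   else v 0 0 *: pq.1 + v 0 1 *: pq.2.
Proof.
case: x => [[[b [[|[|[|[|//]]]] ?]]|]|] /=; try (case: b).
all: rewrite inordK //=.
all: rewrite /frame /slope /basis_quat /=.
all: rewrite -[RHS](@hsubmxK _ 1 2 2) (@mul_mx_row _ _ _ 2 2).
all: congr (@row_mx _ _ 2 2 _ _).
all: apply/rowP => -[[|[|//]] ?].
all: rewrite !mxE ?big_ord_recl ?big_ord0 ?mxE /=.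
all: rewrite ?big_ord_recl ?big_ord0 ?mxE /=.
all: by rewrite lift0_ord2 ord0_0; ring.
Qed.

Lemma framed_ten_line x : framed i (ten_line R (line_index x)) x.
Proof.
move=> w; suff h : reflect (exists v, w = v *m frame i x) (w \in ten_span R (line_index x)).
  by apply/h/eqP; rewrite coframe_eq0.
move: (@mul_frame x); rewrite /ten_span; move: (nth _ _ _) => [p q] hB.
case: x hB => [[t|]|] hB; first exact: mem_span2.
  by rewrite addvC; apply: mem_span2.
by rewrite addvC; apply: mem_span2.
Qed.

Lemma label_exists (L : ten_lines R) : exists x, framed i (val L) x.
Proof.
have [j _ <-] := set_valP L; have [x <-] := line_index_surj j.
by exists x; apply: framed_ten_line.
Qed.

Definition label_of (L : ten_lines R) : label := sval (cid (label_exists L)).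

Lemma label_ofP L : framed i (val L) (label_of L).
Proof. exact: svalP. Qed.

Lemma framed_unique (L : line C) x y : framed i L x -> framed i L y -> x = y.
Proof.
move=> Lx Ly; have := framed_skew sqr_iC Lx Lx.
by rewrite (framed_skew sqr_iC Lx Ly) eqxx => /negbFE/eqP.
Qed.

Lemma label_of_surj x : exists L, label_of L = x.
Proof.
have mem : ten_line R (line_index x) \in ten_lines R.
  by apply/mem_set; exists (line_index x).
exists (exist _ (ten_line R (line_index x)) mem); apply: framed_unique (label_ofP _) _.
exact: framed_ten_line.
Qed.

(** Induction on compositions: a projection acts by a quotient of two values of [cross], each of
    which permutes the diagonals. *)
Lemma Pi_acts (L M : ten_lines R) (f : point_on (val L) -> point_on (val M)) :
  Pi f -> exists s T, diag_perm i T s /\ acts i (label_of L) (label_of M) f T.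
Proof.
elim=> {L M f} [L L' L'' sk sk'|L|L M N f g _ [s [T [oT fT]]] _ [t [U [oU gU]]]].
- have xy := framed_skew sqr_iC (label_ofP L) (label_ofP L').
  have yz := framed_skew sqr_iC (label_ofP L') (label_ofP L'').
  have [s os] := octahedral_cross sqr_iC (etrans (esym xy) sk).
  have [|t ot] := @octahedral_cross _ _ sqr_iC (label_of L'') (label_of L').
    by rewrite eq_sym -yz.
  exists (s * t^-1)%g; eexists; split; first exact: diag_permM os (diag_permV ot).
  exact (acts_proj sqr_iC _ _ (label_ofP L) (label_ofP L') (label_ofP L'')).
- by exists 1%g, 1; split; [exact: diag_perm1|exact: acts_id].
- exists (s * t)%g, (T * U); split; first exact: diag_permM.
  exact: acts_comp fT gU.
Qed.

(** * Loops realising every permutation *)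

(** Stated on labels, with the lines quantified inside, so that paths compose without transporting
    maps between dependent types. *)
Definition reach (x y : label) (s : 'S_4) : Prop :=
  forall L M : ten_lines R, label_of L = x -> label_of M = y ->
  exists2 f : point_on (val L) -> point_on (val M), Pi f &
  exists2 T, diag_perm i T s & acts i x y f T.

Lemma reach_comp y x z s t : reach x y s -> reach y z t -> reach x z (s * t)%g.
Proof.
move=> xy yz L N Lx Nz; have [M My] := label_of_surj y.
have [f Pf [T oT fT]] := xy L M Lx My; have [g Pg [U oU gU]] := yz M N My Nz.
exists (g \o f); first exact: Pi_comp.
by exists (T * U); [apply: diag_permM|apply: acts_comp fT gU].
Qed.

Lemma reach_proj y x z s : x != y -> z != y ->
  diag_perm i (cross i x y * (cross i z y)^-1) s -> reach x z s.
Proof.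
move=> + + + L N Lx Nz; have [M My] := label_of_surj y; subst x y z => LM NM os.
have sk : Defs.skew (val L) (val M) by rewrite (framed_skew sqr_iC (label_ofP L) (label_ofP M)).
have sk' : Defs.skew (val M) (val N).
  by rewrite (framed_skew sqr_iC (label_ofP M) (label_ofP N)) eq_sym.
exists (proj sk sk'); first exact: Pi_proj.
exists (cross i (label_of L) (label_of M) * (cross i (label_of N) (label_of M))^-1) => //.
exact (acts_proj sqr_iC _ _ (label_ofP L) (label_ofP M) (label_ofP N)).
Qed.

Lemma reach_id s t : reach (Some s) (Some t) 1%g.
Proof.
apply: (@reach_proj None) => //.
by rewrite !cross_infr mul1r invr1; apply: diag_perm1.
Qed.

Definition unit_slope : option (bool * 'I_4) := Some (false, 0).

Lemma slope_unit : slope i unit_slope = 1.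
Proof. by rewrite /slope /basis_quat /= scale1r quat_scalar. Qed.

(** Projecting through [L_7], of slope 0: the lines of slopes 1 and oo both have [cross] equal to 1
    with it. *)
Lemma reach_infr : reach (Some unit_slope) None 1%g.
Proof.
apply: (@reach_proj (Some None)) => //.
rewrite cross_slopes cross_infl slope_unit subr0 mul1r invr1.
exact: diag_perm1.
Qed.

Lemma reach_infl : reach None (Some unit_slope) 1%g.
Proof.
apply: (@reach_proj (Some None)) => //.
rewrite cross_slopes cross_infl slope_unit subr0 mul1r invr1.
exact: diag_perm1.
Qed.

(** The loop goes from slope 1 to slope [m] through [L_0], on to [L_0] through slope [n], and back
    to slope 1 through [L_7]. Only the middle step, with matrix [slope m - slope n], permutes the
    diagonals nontrivially. *)
Lemma reach_tperm k l : reach (Some unit_slope) (Some unit_slope) (tperm k l).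
Proof.
have [->|kl] := eqVneq k l; first by rewrite tperm1; apply: reach_id.
have [m [n oT]] := diag_perm_slope sqr_iC kl.
have mn : m != n by apply: contraTneq oT.1 => ->; rewrite subrr unitmxE det0 unitr0.
have h : reach (Some m) None (tperm k l).
  have n0 : None != Some n by [].
  refine (@reach_proj (Some n) (Some m) None _ mn n0 _).
  by rewrite cross_slopes cross_infl invr1 mulr1.
have := reach_comp (reach_comp (@reach_id unit_slope m) h) reach_infl.
by rewrite mul1g mulg1; apply.
Qed.

(** Transpositions generate ['S_4], and paths with trivial permutation carry the loops at slope 1 to
    every other line. *)
Lemma reach_full x s : reach x x s.
Proof.
have h : reach (Some unit_slope) (Some unit_slope) s.
  have [ts -> _] := prod_tpermP s.
  elim: ts => [|t ts IH]; first by rewrite big_nil; apply: reach_id.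
  by rewrite big_cons; apply: reach_comp (reach_tperm _ _) IH.
case: x => [t|].
  have := reach_comp (reach_comp (@reach_id t unit_slope) h) (@reach_id unit_slope t).
  by rewrite mul1g mulg1.
have := reach_comp (reach_comp reach_infl h) reach_infr.
by rewrite mul1g mulg1.
Qed.

(** * The isomorphism from an automorphism group to ['S_4] *)

Section Automorphisms.
Variable L : ten_lines R.

Lemma aut_perm_exists (f : groupoid_aut L) :
  exists s T, diag_perm i T s /\ acts i (label_of L) (label_of L) f T.
Proof. exact: Pi_acts (aut_Pi f). Qed.

(* The permutations compose in the order opposite to the maps, hence the inverse. *)
Definition aut_perm (f : groupoid_aut L) : 'S_4 := (sval (cid (aut_perm_exists f)))^-1%g.

Lemma aut_permP (f : groupoid_aut L) T s :
  diag_perm i T s -> acts i (label_of L) (label_of L) f T -> aut_perm f = s^-1%g.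
Proof.
rewrite /aut_perm; case: cid => t [U [oU fU]] /= oT fT; congr (_^-1)%g.
exact: (acts_diag_perm_unique sqr_iC (label_ofP L) fU fT oU oT).
Qed.

Lemma aut_permM : {morph aut_perm : f g / (f * g)%g}.
Proof.
move=> f g.
have [s [T [oT fT]]] := aut_perm_exists f; have [t [U [oU gU]]] := aut_perm_exists g.
rewrite (aut_permP oT fT) (aut_permP oU gU) -invMg.
apply: (@aut_permP _ (U * T)); first exact: diag_permM.
exact: acts_comp gU fT.
Qed.

Lemma aut_perm_inj : injective aut_perm.
Proof.
move=> f g.
have [s [T [oT fT]]] := aut_perm_exists f; have [t [U [oU gU]]] := aut_perm_exists g.
rewrite (aut_permP oT fT) (aut_permP oU gU) => /invg_inj st.
(* Equal permutations make the matrices proportional, and proportional matrices act alike on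
   points. *)
rewrite -{t}st in oU; have [c c0 e] := diag_perm_unique sqr_iC oT oU.
apply: aut_eq; apply: acts_eq (label_ofP L) fT _.
by rewrite e; apply: actsZ.
Qed.

Lemma aut_perm_surj s : exists f, aut_perm f = s.
Proof.
have [f Pf [T oT fT]] := @reach_full _ s^-1%g L L erefl erefl.
by exists (GroupoidAut Pf); rewrite (@aut_permP (GroupoidAut Pf) _ _ oT fT) invgK.
Qed.

HB.instance Definition _ :=
  isMultiplicative.Build (groupoid_aut L) 'S_4 aut_perm aut_permM.

Lemma aut_perm_bij : bijective aut_perm.
Proof.
pose g s := sval (cid (aut_perm_surj s)).
have gK : cancel g aut_perm by move=> s; rewrite /g; case: cid.
by exists g => // f; apply: aut_perm_inj; rewrite gK.
Qed.

End Automorphisms.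
End TenLines.

Theorem theorem4 (R : realType) (L : ten_lines R) :
  isomorphic_groups (groupoid_aut L) 'S_4.
Proof. by exists (@aut_perm R L); apply: aut_perm_bij. Qed.
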